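(* Let $p$ be a prime, let $R$ be a GNC ring with $p \in Nil(R)$, and let $G$ be a locally finite $p$-group. Then the group ring $RG$ is GNC.
   Context: Rings are associative with identity, not necessarily commutative. $Nil(R)$ is the set of nilpotent elements of $R$; $p\in Nil(R)$ means that $p\cdot 1_R$ is nilpotent. An element is nil-clean if it is the sum of an idempotent and a nilpotent element (not required to commute). A ring is GNC (generalized nil-clean) if all its non-units are nil-clean. A $p$-group is a group in which every element has order a power of $p$; a group is locally finite if every finitely generated subgroup is finite. *)

(* Defs.v *)
From HB Require Import structures.
From mathcomp Require Import all_boot all_algebra.
From mathcomp Require Import boolp classical_sets cardinality.
From mathcomp Require Import finmap monalg.

Set Implicit Arguments.
Unset Strict Implicit.
Unset Printing Implicit Defensive.

Import GRing.Theory.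

(* Rings are pzRingType: associative and unital, not necessarily commutative,
   with the zero ring allowed. GRing.unit is not available at this level (it
   requires a decision procedure for invertibility), hence the Prop-valued
   two-sided version below. *)
Section NilClean.
Local Open Scope ring_scope.
Variable R : pzRingType.
Implicit Types x : R.

Definition is_unit x : Prop := exists y : R, x * y = 1 /\ y * x = 1.

Definition is_nilpotent x : Prop := exists n : nat, x ^+ n = 0.

Definition is_idempotent x : Prop := x * x = x.

Definition nil_clean x : Prop :=
  exists e b : R, [/\ is_idempotent e, is_nilpotent b & x = e + b].

End NilClean.

Definition GNC (R : pzRingType) : Prop :=
  forall x : R, ~ is_unit x -> nil_clean x.

Section Groups.
Local Open Scope group_scope.
Local Open Scope classical_set_scope.
Variable G : groupType.

Definition is_subgroup (H : set G) : Prop :=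
  [/\ H 1, forall x y, H x -> H y -> H (x * y) & forall x, H x -> H x^-1].

Definition generated (A : set G) : set G := smallest is_subgroup A.

Definition locally_finite : Prop :=
  forall A : set G, finite_set A -> finite_set (generated A).

Definition has_order (x : G) (n : nat) : Prop :=
  [/\ (0 < n)%N, x ^+ n = 1
    & forall m : nat, (0 < m)%N -> x ^+ m = 1 -> (n <= m)%N].

Definition is_p_group (p : nat) : Prop :=
  forall x : G, exists k : nat, has_order x (p ^ k)%N.

End Groups.

(* {malg R[G]} is the group of finitely supported functions G -> R; the
   multiplication monalg puts on it is restricted to monoids without
   nontrivial units, so the convolution product is defined here.
   << c *g g >> is the element c g of RG and x@_g the coefficient of x at g. *)
Definition group_ring (R : pzRingType) (G : groupType) : Type := {malg R[G]}.

HB.instance Definition _ (R : pzRingType) (G : groupType) :=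
  GRing.Zmodule.on (group_ring R G).

Section GroupRing.
Local Open Scope ring_scope.
Local Open Scope fset_scope.
Variables (R : pzRingType) (G : groupType).
Implicit Types (x y z : group_ring R G) (g h : G).

Definition gr_one : group_ring R G := << (1 : R) *g (1%g : G) >>.

Definition gr_mul x y : group_ring R G :=
  \sum_(g <- msupp x) \sum_(h <- msupp y) << x@_g * y@_h *g (g * h)%g >>.

Lemma gr_mulEw (d1 d2 : {fset G}) x y :
    msupp x `<=` d1 -> msupp y `<=` d2 ->
  gr_mul x y =
    \sum_(g <- d1) \sum_(h <- d2) << x@_g * y@_h *g (g * h)%g >>.
Proof.
move=> le_d1 le_d2; rewrite /gr_mul (big_fset_incl _ le_d1) /=.
  apply/eq_bigr=> g _; apply/big_fset_incl => // h _ /mcoeff_outdom ->.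
  by rewrite mulr0 monalgU0.
move=> g _ /mcoeff_outdom xg.
by rewrite big1 => // h _; rewrite xg mul0r monalgU0.
Qed.

Lemma gr_mulUU (c1 c2 : R) g1 g2 :
  gr_mul << c1 *g g1 >> << c2 *g g2 >> = << c1 * c2 *g (g1 * g2)%g >>.
Proof. by rewrite (gr_mulEw msuppU_le msuppU_le) !big_seq_fset1 !mcoeffUU. Qed.

Lemma gr_mulDl : left_distributive gr_mul +%R.
Proof.
move=> x y z.
rewrite (@gr_mulEw (msupp x `|` msupp y) (msupp z) x z) ?fsubsetUl //.
rewrite (@gr_mulEw (msupp x `|` msupp y) (msupp z) y z) ?fsubsetUr //.
rewrite (@gr_mulEw (msupp x `|` msupp y) (msupp z)) ?msuppD_le //.
rewrite -big_split /=; apply/eq_bigr=> g _.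
rewrite -big_split /=; apply/eq_bigr=> h _.
by rewrite mcoeffD mulrDl monalgUD.
Qed.

Lemma gr_mulDr : right_distributive gr_mul +%R.
Proof.
move=> x y z.
rewrite (@gr_mulEw (msupp x) (msupp y `|` msupp z) x y) ?fsubsetUl //.
rewrite (@gr_mulEw (msupp x) (msupp y `|` msupp z) x z) ?fsubsetUr //.
rewrite (@gr_mulEw (msupp x) (msupp y `|` msupp z)) ?msuppD_le //.
rewrite -big_split /=; apply/eq_bigr=> g _.
rewrite -big_split /=; apply/eq_bigr=> h _.
by rewrite mcoeffD mulrDr monalgUD.
Qed.

Lemma gr_mul0l : left_zero 0 gr_mul.
Proof. by move=> x; rewrite /gr_mul msupp0 big_seq_fset0. Qed.

Lemma gr_mul0r : right_zero 0 gr_mul.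
Proof.
by move=> x; rewrite /gr_mul msupp0; apply: big1 => g _; rewrite big_seq_fset0.
Qed.

Lemma gr_mul_suml x y :
  gr_mul x y = \sum_(g <- msupp x) gr_mul << x@_g *g g >> y.
Proof.
rewrite -(big_morph (gr_mul^~ y) (fun _ _ => gr_mulDl _ _ _) (gr_mul0l _)).
by rewrite -monalgE.
Qed.

Lemma gr_mul_sumr x y :
  gr_mul x y = \sum_(h <- msupp y) gr_mul x << y@_h *g h >>.
Proof.
rewrite -(big_morph (gr_mul x) (fun _ _ => gr_mulDr _ _ _) (gr_mul0r _)).
by rewrite -monalgE.
Qed.

Lemma gr_mul1l : left_id gr_one gr_mul.
Proof.
move=> x; rewrite gr_mul_sumr [RHS]monalgE.
by apply/eq_bigr=> g _; rewrite gr_mulUU mul1r mul1g.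
Qed.

Lemma gr_mul1r : right_id gr_one gr_mul.
Proof.
move=> x; rewrite gr_mul_suml [RHS]monalgE.
by apply/eq_bigr=> g _; rewrite gr_mulUU mulr1 mulg1.
Qed.

Lemma gr_mulA : associative gr_mul.
Proof.
move=> x y z.
rewrite [RHS](big_morph (gr_mul^~ _) (fun _ _ => gr_mulDl _ _ _) (gr_mul0l _)).
rewrite gr_mul_suml; apply/eq_bigr=> g _.
rewrite [LHS](big_morph (gr_mul _) (fun _ _ => gr_mulDr _ _ _) (gr_mul0r _)).
rewrite [RHS](big_morph (gr_mul^~ _) (fun _ _ => gr_mulDl _ _ _) (gr_mul0l _)).
apply/eq_bigr=> h _.
rewrite [LHS](big_morph (gr_mul _) (fun _ _ => gr_mulDr _ _ _) (gr_mul0r _)).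
by rewrite gr_mul_sumr; apply/eq_bigr=> k _; rewrite !gr_mulUU mulrA mulgA.
Qed.

HB.instance Definition _ := GRing.Zmodule_isPzRing.Build (group_ring R G)
  gr_mulA gr_mul1l gr_mul1r gr_mulDl gr_mulDr.

End GroupRing.

(* Main.v *)
(* The augmentation RG -> R is split by the constants R -> RG, and its kernel is
   a nil ideal; hence units lift along it, and if aug x = e + b with e
   idempotent and b nilpotent, then x = e + (x - e) where x - e has nilpotent
   augmentation b and is therefore nilpotent.

   For the nilpotency of an x of augmentation 0, let H be the finite p-group
   generated by its support, and p^k = 0 in R. The powers of x are combinations
   of products of elements h - 1 with h in H, and long products of this kind
   vanish already in (Z/p^k)[H]: the semidirect product of the additive group of
   (Z/p^k)[H] by H is a finite p-group, hence nilpotent, and the product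
   (h_1 - 1)...(h_N - 1) is its iterated commutator [1, h_1, ..., h_N]. *)
Require Import Defs.
From mathcomp Require Import all_boot all_algebra.
From HB Require Import structures.
From mathcomp Require Import all_fingroup all_solvable.
From mathcomp Require Import boolp classical_sets cardinality.
From mathcomp Require Import finmap monalg.

Set Implicit Arguments.
Unset Strict Implicit.
Unset Printing Implicit Defensive.

Import GRing.Theory.

Local Open Scope group_scope.
Local Open Scope ring_scope.

(** * Semidirect products and unipotent actions of finite p-groups *)

Section AffineGroup.
Variables (V : finZmodType) (gT : finGroupType) (act : V -> gT -> V).

Definition right_action : Prop :=
  [/\ forall v, act v 1%g = v,
      forall v g h, act v (g * h)%g = act (act v g) h
    & forall g u v, act (u + v) g = act u g + act v g].

(* The phantom argument lets the group structure of V ><| gT depend on the laws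
   of the action. *)
Definition affine of right_action : Type := (V * gT)%type.

Variable actP : right_action.

Let act0 g : act 0 g = 0.
Proof.
by have [_ _ actD] := actP; apply: (addrI (act 0 g)); rewrite -actD !addr0.
Qed.

Local Notation aT := (affine actP).

HB.instance Definition _ := Finite.on aT.

(** The pair [(v, g)] stands for the affine map taking [u] to [act u g + v]; products compose these
    maps, left factor first. *)
Definition affine_mul (x y : aT) : aT := (act x.1 y.2 + y.1, (x.2 * y.2)%g).
Definition affine_one : aT := (0, 1%g).
Definition affine_inv (x : aT) : aT := (- act x.1 x.2^-1%g, x.2^-1%g).

Fact affine_mulA : associative affine_mul.
Proof.
have [_ actM actD] := actP.
by move=> x y z; rewrite /affine_mul /= actD actM addrA mulgA.
Qed.

Fact affine_mul1 : left_id affine_one affine_mul.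
Proof.
case=> v g; rewrite /affine_mul /= mul1g; congr (_, _).
by rewrite act0 add0r.
Qed.

Fact affine_mulV : left_inverse affine_one affine_inv affine_mul.
Proof.
have [act1 actM actD] := actP.
case=> v g; rewrite /affine_mul /affine_inv /= mulVg; congr (_, _).
by rewrite -[X in _ + X]act1 -(mulVg g) actM -actD addNr act0.
Qed.

HB.instance Definition _ :=
  Finite_isGroup.Build aT affine_mulA affine_mul1 affine_mulV.

Let affine_mulE (x y : aT) : (x * y)%g = affine_mul x y. Proof. by []. Qed.
Let affine_invE (x : aT) : x^-1%g = affine_inv x. Proof. by []. Qed.

Lemma pgroup_unipotent (p : nat) :
    p.-nat #|V| -> p.-group [set: gT] ->
  exists N, forall (v : V) (s : seq gT), size s = N ->
    foldl (fun u h => act u h - u) v s = 0.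
Proof.
move=> pV pG; have [act1 actM actD] := actP.
have /pgroup_nil/lcnP[N LN] : p.-group [set: aT].
  by rewrite /pgroup cardsT card_prod pnatM pV -cardsT.
exists N => v s sN.
(* Each step of the fold is a commutator with some [(0, h)], so it descends one term of the lower
   central series; the index is [(size s).+1] because ['L_1] is the whole group. *)
suff: ((foldl (fun u h => act u h - u) v s, 1%g) : aT)
    \in 'L_(size s).+1([set: aT]).
  by rewrite sN LN => /set1P [].
elim/last_ind: s {sN} => [|s h IH]; first by rewrite lcn1 inE.
rewrite foldl_rcons size_rcons lcnSn; set u := foldl _ _ _ in IH *.
suff -> : (act u h - u, 1%g) = [~ ((u, 1%g) : aT), ((0, h) : aT)].
  by rewrite mem_commg ?inE.
rewrite /commg /conjg !affine_mulE !affine_invE /affine_mul /affine_inv /=.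
by rewrite act0 invg1 oppr0 !mul1g mulVg !act1 act0 add0r addr0 addrC.
Qed.

End AffineGroup.

(** * Translation on functions over a finite group *)

HB.instance Definition _ (I : finType) (V : finZmodType) :=
  Finite.on {ffun I -> V}.

Section RightShift.
Variables (V : finZmodType) (gT : finGroupType).

(** Right multiplication by [g] on formal sums of group elements, seen on their coefficient
    functions. *)
Definition right_shift (w : {ffun gT -> V}) (g : gT) : {ffun gT -> V} :=
  [ffun x => w (x * g^-1)%g].

Lemma right_shiftP : right_action right_shift.
Proof.
split=> [v|v g h|g u v]; apply/ffunP => x; rewrite !ffunE ?invg1 ?mulg1 //.
by rewrite invMg mulgA.
Qed.

End RightShift.

(** * Vanishing of long products of differences [f h - 1] *)

Section UnipotentRing.
Variables (A : pzRingType) (gT : finGroupType) (f : gT -> A).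
Hypotheses (f1 : f 1%g = 1) (fM : {morph f : x y / (x * y)%g >-> x * y}).

Lemma natr_mod (m n : nat) : m%:R = 0 :> A -> (n %% m)%:R = n%:R :> A.
Proof.
by move=> m0; rewrite {2}(divn_eq n m) natrD natrM m0 mulr0 add0r.
Qed.

Lemma pgroup_prod_sub1_eq0 (p k : nat) :
    prime p -> p.-group [set: gT] -> (p ^ k.+1)%:R = 0 :> A ->
  exists N, forall s : seq gT, size s = N -> \prod_(h <- s) (f h - 1) = 0.
Proof.
move=> p_pr pG; set m := (p ^ k.+1)%N => m0.
(* ['Z_m] has [m] elements only for [m > 1], hence the exponent [k.+1]. *)
have m_gt1 : (1 < m)%N by rewrite -(exp1n k.+1) ltn_exp2r // prime_gt1.
have Zm : (Zp_trunc m).+2 = m by exact: Zp_cast.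
have natZ (n : nat) : (n %% (Zp_trunc m).+2)%:R = n%:R :> A.
  by rewrite Zm natr_mod.
(* The linear extension of [f] to [(Z/m)[gT]]; passing through representatives in [nat] is additive
   because [m] vanishes in [A]. *)
pose phi (w : {ffun gT -> 'Z_m}) : A := \sum_x (w x : nat)%:R * f x.
have phiD : {morph phi : u v / u + v}.
  move=> u v; rewrite /phi -big_split; apply: eq_bigr => x _ /=.
  by rewrite -mulrDl -natrD !ffunE /= natZ.
have phi0 : phi 0 = 0 by apply: (addrI (phi 0)); rewrite -phiD !addr0.
have phiN u : phi (- u) = - phi u.
  by apply: (addrI (phi u)); rewrite -phiD !subrr.
have phi_shift w h : phi (right_shift w h) = phi w * f h.
  rewrite /phi mulr_suml (reindex_inj (mulIg h)) /=; apply: eq_bigr => x _.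
  by rewrite ffunE mulgK fM mulrA.
have pV : p.-nat #|{ffun gT -> 'Z_m}|.
  by rewrite card_ffun card_ord Zm !pnatX pnat_id.
have [N HN] := pgroup_unipotent (@right_shiftP 'Z_m gT) pV pG.
exists N => s sN.
(* [w0] is the identity of [(Z/m)[gT]], so [phi w0 = 1]; each step of the fold multiplies the image
   under [phi] by [f h - 1] on the right. *)
pose w0 : {ffun gT -> 'Z_m} := [ffun x => (x == 1%g)%:R].
have -> : \prod_(h <- s) (f h - 1) =
    phi (foldl (fun u h => right_shift u h - u) w0 s).
  have {1}<- : phi w0 * \prod_(h <- s) (f h - 1) = \prod_(h <- s) (f h - 1).
    rewrite /phi (bigD1 1%g) //= big1 ?addr0 => [|x /negPf x1].
      by rewrite ffunE eqxx /= natZ f1 !mul1r.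
    by rewrite ffunE x1 /= mul0r.
  elim: s {sN} w0 => [|h s IH] w /=; first by rewrite big_nil mulr1.
  by rewrite big_cons -IH phiD phiN phi_shift mulrA mulrBr mulr1.
by rewrite HN.
Qed.

End UnipotentRing.

(** * The augmentation, its section by constants, and its kernel *)

Section Augmentation.
Local Open Scope fset_scope.
Variables (R : pzRingType) (G : groupType).
Implicit Types (x y : group_ring R G) (g h : G) (c : R).

Definition aug x : R := \sum_(g <- msupp x) x@_g.

Lemma augEw (d : {fset G}) x : msupp x `<=` d -> aug x = \sum_(g <- d) x@_g.
Proof. by move=> le_d; apply: big_fset_incl => // g _ /mcoeff_outdom. Qed.

Fact aug_is_zmod_morphism : zmod_morphism aug.
Proof.
move=> x y.
rewrite (@augEw (msupp x `|` msupp y) x) ?fsubsetUl //.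
rewrite (@augEw (msupp x `|` msupp y) y) ?fsubsetUr //.
rewrite (@augEw (msupp x `|` msupp y)) ?msuppB_le // -sumrB.
by apply: eq_bigr => g _; rewrite mcoeffB.
Qed.

HB.instance Definition _ :=
  GRing.isZmodMorphism.Build (group_ring R G) R aug aug_is_zmod_morphism.

Lemma augU c g : aug << c *g g >> = c.
Proof. by rewrite (augEw msuppU_le) big_seq_fset1 mcoeffUU. Qed.

Fact aug_is_monoid_morphism : monoid_morphism aug.
Proof.
split=> [|x y]; first exact: augU.
rewrite [x * y]/(gr_mul x y) /gr_mul raddf_sum mulr_suml.
apply: eq_bigr => g _; rewrite raddf_sum mulr_sumr.
by apply: eq_bigr => h _; rewrite /= augU.
Qed.

HB.instance Definition _ :=
  GRing.isMonoidMorphism.Build (group_ring R G) R aug aug_is_monoid_morphism.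

Definition gr_const c : group_ring R G := << c *g (1%g : G) >>.

Fact gr_const_is_zmod_morphism : zmod_morphism gr_const.
Proof. exact: monalgUB. Qed.

Fact gr_const_is_monoid_morphism : monoid_morphism gr_const.
Proof.
by split=> // c1 c2; rewrite [RHS]gr_mulUU mulg1.
Qed.

HB.instance Definition _ := GRing.isZmodMorphism.Build
  R (group_ring R G) gr_const gr_const_is_zmod_morphism.
HB.instance Definition _ := GRing.isMonoidMorphism.Build
  R (group_ring R G) gr_const gr_const_is_monoid_morphism.

Lemma augC c : aug (gr_const c) = c.
Proof. exact: augU. Qed.

Definition gr_of g : group_ring R G := << 1 *g g >>.

Lemma gr_ofM : {morph gr_of : g h / (g * h)%g >-> g * h}.
Proof. by move=> g h; rewrite [RHS]gr_mulUU mulr1. Qed.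

Lemma gr_ofC c g : gr_of g * gr_const c = gr_const c * gr_of g.
Proof. by rewrite [LHS]gr_mulUU [RHS]gr_mulUU mulr1 mul1r mulg1 mul1g. Qed.

Lemma gr_constM_of c g : gr_const c * gr_of g = << c *g g >>.
Proof. by rewrite [LHS]gr_mulUU mulr1 mul1g. Qed.

(** Replacing each [g] by [g - 1] subtracts only the constant [aug x], which is 0. *)
Lemma aug0_sumE x : aug x = 0 ->
  x = \sum_(g <- msupp x) gr_const x@_g * (gr_of g - 1).
Proof.
move=> x0; under eq_bigr do rewrite mulrBr mulr1 gr_constM_of.
rewrite sumrB -(raddf_sum gr_const) -[\sum_(g <- _) _@_g]/(aug x).
rewrite x0 raddf0 subr0.
exact: monalgE.
Qed.

(** Constants commute with group elements, so in the expanded power all coefficients gather on the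
    left of products of [N] differences. *)
Lemma aug0_nilpotent x (N : nat) : aug x = 0 ->
    (forall s : seq G, {subset s <= msupp x} -> size s = N ->
       \prod_(h <- s) (gr_of h - 1) = 0) ->
  x ^+ N = 0.
Proof.
move=> x0 prod0.
(* Here [n] factors [x] remain to be expanded, while [s] and [c] record the differences and the
   coefficient already extracted. *)
suff H n (s : seq G) c : {subset s <= msupp x} -> (n + size s = N)%N ->
    x ^+ n * (gr_const c * \prod_(h <- s) (gr_of h - 1)) = 0.
  by have /= := H N [::] 1; rewrite big_nil rmorph1 !mulr1 addn0 => ->.
elim: n s c => [|n IH] s c s_x sN.
  by rewrite prod0 // !mulr0.
rewrite exprSr -mulrA {2}[x](aug0_sumE x0) mulr_suml mulr_sumr.
rewrite big_seq big1 // => g g_x.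
apply: etrans (IH (g :: s) (x@_g * c) _ _); last by rewrite /= addnS.
  rewrite big_cons rmorphM /= -!mulrA; congr (_ * (_ * _)).
  by rewrite !mulrA; congr (_ * _); rewrite mulrBl mulrBr mul1r mulr1 gr_ofC.
by move=> h; rewrite inE => /predU1P[->|/s_x].
Qed.

End Augmentation.

(** * Finite subgroups of [G] as abstract finite groups *)

Section FiniteSubgroup.
Variable G : groupType.

Lemma is_subgroup_generated (A : set G) : is_subgroup (Defs.generated A).
Proof.
by split=> [|x y xA yA|x xA] B BP; have [[B1 BM BV] _] := BP;
  [exact: B1 | apply: BM; [exact: xA | exact: yA] | apply: BV; exact: xA].
Qed.

Lemma fset_subgroup_finGroupType (K : {fset G}) :
    is_subgroup [set` K]%classic ->
  exists (gT : finGroupType) (f : gT -> G),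
    [/\ f 1%g = 1%g, {morph f : x y / (x * y)%g},
        injective f & forall x, x \in K -> exists y, f y = x].
Proof.
case=> K1 KM KV.
have closK : group_closed (mem K).
  by split=> // x y xK yK; apply: KM => //; apply: KV.
pose gT := HB.pack_for finGroupType K
  (SubChoice_isSubGroup.Build G (mem K) K closK).
exists gT, val; split => //.
- exact: val_inj.
- by move=> x xK; exists [` xK]%fset.
Qed.

(** By Cauchy, a prime [q] dividing the order of [gT] is the order of some element; that order
    divides a power of [p], so [q = p]. *)
Lemma p_group_pgroup (p : nat) (gT : finGroupType) (f : gT -> G) :
    prime p -> is_p_group G p -> f 1%g = 1%g -> {morph f : x y / (x * y)%g} ->
  injective f -> p.-group [set: gT].
Proof.
move=> p_pr pG f1 fM f_inj; apply/pgroupP => q q_pr /Cauchy[//|x _ ox].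
have fX n : f (x ^+ n)%g = (f x ^+ n)%g.
  by elim: n => [|n IH]; rewrite ?expg0 // !expgS fM IH.
have [k [_ xk _]] := pG (f x).
have: (x ^+ (p ^ k))%g == 1%g by rewrite -(inj_eq f_inj) fX xk f1.
by rewrite -order_dvdn ox Euclid_dvdX // dvdn_prime2 // => /andP[].
Qed.

End FiniteSubgroup.

(** * Lifting nilpotents and units along the augmentation *)

Section NilAugmentationIdeal.
Variables (p : nat) (R : pzRingType) (G : groupType).
Hypotheses (p_pr : prime p) (p_nil : is_nilpotent (p%:R : R)).
Hypotheses (lfG : locally_finite G) (pG : is_p_group G p).

Lemma nil_aug_ideal (x : group_ring R G) : aug x = 0 -> is_nilpotent x.
Proof.
have [k pk] := p_nil => x0.
have /lfG/finite_fsetP[K gK] : finite_set [set` msupp x]%classic by [].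
have x_K g : g \in msupp x -> g \in K.
  move=> gx; suff: [set` K]%classic g by [].
  by rewrite -gK; apply: sub_gen_smallest.
have := is_subgroup_generated [set` msupp x]%classic.
rewrite gK => /fset_subgroup_finGroupType[gT [f [f1 fM f_inj f_surj]]].
have pgT := p_group_pgroup p_pr pG f1 fM f_inj.
have p0 : (p ^ k.+1)%:R = 0 :> group_ring R G.
  by rewrite -(rmorph_nat (@gr_const R G)) natrX exprS pk mulr0 rmorph0.
have F1 : gr_of R (f 1%g) = 1 by rewrite f1.
have FM : {morph (fun y => gr_of R (f y)) : y z / (y * z)%g >-> y * z}.
  by move=> y z; rewrite fM gr_ofM.
have [N HN] := pgroup_prod_sub1_eq0 F1 FM p_pr pgT p0.
exists N; apply: aug0_nilpotent => // s s_x sN.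
(* The support of [x] lies in [K], the image of [f], so words in it lift to [gT]. *)
have [t st] : exists t, s = map f t.
  elim: s s_x {sN} => [|g s IH] s_x; first by exists [::].
  have [|t ->] := IH; first by move=> h hs; apply: s_x; rewrite inE hs orbT.
  have [|y <-] := f_surj g; first by apply/x_K/s_x; rewrite inE eqxx.
  by exists (y :: t).
by rewrite st big_map; apply: HN; rewrite -sN st size_map.
Qed.

Lemma aug_nilpotent (x : group_ring R G) :
  is_nilpotent (aug x) -> is_nilpotent x.
Proof.
case=> m xm; have [|n xn] := @nil_aug_ideal (x ^+ m); first by rewrite rmorphXn.
by exists (m * n)%N; rewrite exprM.
Qed.

(** If [v] inverts [aug x], then [x] times the constant [v], on either side, has augmentation 1;
    such elements are 1 minus a nilpotent, inverted by a geometric series. Thus [x] has inverses on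
    both sides. *)
Lemma aug_unit (x : group_ring R G) : is_unit (aug x) -> is_unit x.
Proof.
have unit_aug1 (y : group_ring R G) : aug y = 1 -> is_unit y.
  move=> y1; have [|n yn] := @nil_aug_ideal (1 - y).
    by rewrite rmorphB rmorph1 /= y1 subrr.
  exists (\sum_(i < n) (1 - y) ^+ i).
  have yE : y = 1 - (1 - y) by rewrite opprB addrC subrK.
  have yC : (\sum_(i < n) (1 - y) ^+ i) * y = y * \sum_(i < n) (1 - y) ^+ i.
    rewrite mulr_suml mulr_sumr; apply: eq_bigr => i _.
    by apply/commr_sym/commrX/commrB; [apply: commr1 | apply: commr_refl].
  have: y * (\sum_(i < n) (1 - y) ^+ i) = 1.
    by rewrite {1}yE -opprB mulNr -subrX1 yn sub0r opprK.
  by rewrite yC.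
case=> v [xv vx].
have [|l [xl _]] := unit_aug1 (x * gr_const G v);
  first by rewrite rmorphM /= augC.
have [|r [_ rx]] := unit_aug1 (gr_const G v * x);
  first by rewrite rmorphM /= augC.
exists (gr_const G v * l); split; first by rewrite mulrA.
(* A left and a right inverse of [x] coincide. *)
suff <- : r * gr_const G v = gr_const G v * l by rewrite -mulrA.
by rewrite -[LHS]mulr1 -xl !mulrA -(mulrA r) rx mul1r.
Qed.

End NilAugmentationIdeal.

Theorem lemma3p2 (p : nat) (R : pzRingType) (G : groupType) :
  prime p -> GNC R -> is_nilpotent (p%:R : R)%R ->
  locally_finite G -> is_p_group G p ->
  GNC (group_ring R G).
Proof.
move=> p_pr R_gnc p_nil lfG pG x x_nunit.
(* As units lift, [aug x] is a non-unit of [R]. *)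
have [|e [b [ee bb xE]]] := R_gnc (aug x).
  by move=> /(aug_unit p_pr p_nil lfG pG).
exists (gr_const G e), (x - gr_const G e); split.
- by rewrite /is_idempotent -rmorphM ee.
- apply: (aug_nilpotent p_pr p_nil lfG pG).
  by rewrite rmorphB /= augC xE addrC addKr.
- by rewrite addrC subrK.
Qed.
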